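(* Consider the ternary device-independent quantum key distribution protocol based on the Impossible Colouring game (described in the context), with tolerable noise parameter $\eta$, and let $k$ be the length of the entire raw key, so that Alice and Bob obtain raw keys $K_A,K_B\in\{0,1\}^k$. Then the protocol is $\epsilon_{\text{correct}}$-correct with $\epsilon_{\text{correct}}=1-(1-\eta)^k$; that is, $$\Pr(K_A\neq K_B)\le 1-(1-\eta)^k .$$
   Context: A quantum key distribution protocol is $\epsilon$-correct ($\epsilon\ge 0$) if Alice and Bob agree on a $k$-bit key except with failure probability at most $\epsilon$, i.e. their key strings $K_A,K_B\in\{0,1\}^k$ satisfy $\Pr(K_A\ne K_B)\le\epsilon$. Protocol. Let $V^{KS}\subset\mathbb{R}^3$ be a Kochen–Specker set: a finite set of vectors that cannot be $\{0,1\}$-coloured so that at most one vector of each orthogonal pair, and exactly one vector of each mutually orthogonal triple, has colour 1. Alice and Bob share $\mathcal{N}$ copies of the two-qutrit state $\frac{1}{\sqrt3}(|00\rangle+|11\rangle+|22\rangle)$. In each round Alice picks orthogonal $v_1,v_2\in V^{KS}$, tells Bob (in order) which vectors they are, and measures her qutrit in the orthonormal basis obtained by normalizing $\{v_1,v_2,v_a\}$, where $v_a\in\mathbb{R}^3$ is orthogonal to $v_1$ and $v_2$. Bob picks $v_\ell\in\{v_1,v_2\}$ at random and measures his qutrit in an orthonormal basis of $\mathbb{R}^3$ containing the normalized $v_\ell$. Bob publicly announces whether his outcome was $v_\ell$; rounds in which it was not are discarded. On a random subset of the remaining rounds the parties estimate the success probability (how often the Impossible Colouring game condition is satisfied, i.e.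 Alice's outcome agrees with Bob's) and abort if it is below $1-\eta$. In the rounds used for the key, the raw key bit is $0$ if $v_\ell=v_1$ and $1$ if $v_\ell=v_2$: Bob knows his choice of $v_\ell$, and Alice infers $v_\ell$ from her own outcome. The tolerable noise parameter $\eta\in[0,1]$ means that for each position $i$ of the raw key, Alice's and Bob's bits differ with probability at most $\eta$, i.e. $\Pr(K_A^i\neq K_B^i)\le\eta$. Standing assumption: the devices are memoryless, i.e. each use is independent of previous uses and behaves the same in all rounds. *)

(* Defs.v *)
From HB Require Import structures.
From mathcomp Require Import all_boot all_order all_algebra.
From mathcomp Require Import finmap.
From mathcomp Require Import all_classical all_reals all_analysis.
From mathcomp Require Import ring.

Set Implicit Arguments.
Unset Strict Implicit.
Unset Printing Implicit Defensive.

Import Order.TTheory GRing.Theory Num.Theory.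
Local Open Scope classical_set_scope.
Local Open Scope ring_scope.

(* Vectors of R^3 are row vectors. *)

Section KochenSpecker.
Variable R : realType.
Implicit Types (u v w : 'rV[R]_3) (V : {fset 'rV[R]_3}).

Definition dot u v : R := (u *m v^T) 0 0.

Definition orth u v : bool := dot u v == 0.

(* The vectors have to be nonzero, since the protocol normalizes them; it
   follows that the members of an orthogonal pair or triple are distinct. *)
Definition kochen_specker V : Prop :=
  0%R \notin V /\
  ~ exists c : 'rV[R]_3 -> bool,
      (forall u v, u \in V -> v \in V -> orth u v -> ~~ (c u && c v)) /\
      (forall u v w, u \in V -> v \in V -> w \in V ->
         orth u v -> orth u w -> orth v w -> (c u + c v + c w = 1)%N).

Definition normalize u : 'rV[R]_3 := (Num.sqrt (dot u u))^-1 *: u.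

(* Indices of 'I_3 are added modulo 3, so this is the usual cross product. *)
Definition cross u v : 'rV[R]_3 :=
  \row_(k < 3) (u 0 (k + 1) * v 0 (k + 2%:R) - u 0 (k + 2%:R) * v 0 (k + 1)).

Lemma dotE u v :
  dot u v = u 0 0 * v 0 0 + u 0 1 * v 0 1 + u 0 2%:R * v 0 2%:R.
Proof.
rewrite /dot mxE !big_ord_recl big_ord0 addr0 !mxE -!addrA.
by congr (_ + (_ + _)); congr (u _ _ * v _ _); exact/val_inj.
Qed.

Lemma dotC u v : dot u v = dot v u.
Proof. by rewrite !dotE; ring. Qed.

Lemma dotZZ a b u v : dot (a *: u) (b *: v) = a * b * dot u v.
Proof. by rewrite !dotE !mxE; ring. Qed.

Lemma dotZl a u v : dot (a *: u) v = a * dot u v.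
Proof. by rewrite -[v in LHS]scale1r dotZZ mulr1. Qed.

Lemma dot_ge0 u : 0 <= dot u u.
Proof. by rewrite dotE -!expr2 !addr_ge0 ?sqr_ge0. Qed.

Lemma dot_eq0 u : (dot u u == 0) = (u == 0).
Proof.
apply/eqP/eqP => [|->]; last by rewrite dotE !mxE; ring.
rewrite dotE -!expr2 => /eqP.
rewrite paddr_eq0 ?addr_ge0 ?sqr_ge0// paddr_eq0 ?sqr_ge0// !sqrf_eq0.
move=> /andP[/andP[/eqP u0 /eqP u1] /eqP u2].
apply/rowP => i; rewrite mxE.
have : [|| i == 0, i == 1 | i == 2%:R] by case: i => -[|[|[|]]].
by case/or3P => /eqP ->.
Qed.

Lemma crossE u v : [/\ cross u v 0 0 = u 0 1 * v 0 2%:R - u 0 2%:R * v 0 1,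
  cross u v 0 1 = u 0 2%:R * v 0 0 - u 0 0 * v 0 2%:R &
  cross u v 0 2%:R = u 0 0 * v 0 1 - u 0 1 * v 0 0].
Proof.
have e1 : (0 + 1 = 1 :> 'I_3) /\ (0 + 2%:R = 2%:R :> 'I_3) by split; exact/val_inj.
have e2 : (1 + 1 = 2%:R :> 'I_3) /\ (1 + 2%:R = 0 :> 'I_3) by split; exact/val_inj.
have e3 : (2%:R + 1 = 0 :> 'I_3) /\ (2%:R + 2%:R = 1 :> 'I_3) by split; exact/val_inj.
by rewrite !mxE (e1.1, e1.2) !(e1.2, e2.1, e2.2, e3.1, e3.2).
Qed.

Lemma dot_crossl u v : dot (cross u v) u = 0.
Proof. by rewrite dotE; have [-> -> ->] := crossE u v; ring. Qed.

Lemma dot_crossr u v : dot (cross u v) v = 0.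
Proof. by rewrite dotE; have [-> -> ->] := crossE u v; ring. Qed.

Lemma dot_cross u v :
  dot (cross u v) (cross u v) = dot u u * dot v v - dot u v ^+ 2.
Proof. by rewrite !dotE; have [-> -> ->] := crossE u v; ring. Qed.

Lemma dot_normalize u : u != 0 -> dot (normalize u) (normalize u) = 1.
Proof.
move=> u0; rewrite dotZZ -expr2 exprVn sqr_sqrtr ?dot_ge0//.
by rewrite mulVf// dot_eq0.
Qed.

Lemma dot_normalize0 u v : dot u v = 0 -> dot (normalize u) (normalize v) = 0.
Proof. by move=> uv0; rewrite dotZZ uv0 mulr0. Qed.

End KochenSpecker.

Section Devices.
Variables (R : realType) (V : {fset 'rV[R]_3}).

(* Alice's outcome: [Some false], [Some true] and [None] stand for the
   (normalized) vectors v1, v2 and va. *)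
Definition alice_out := option bool.

(* Bob's outcome: [true] when he obtains the vector he has chosen. *)
Definition bob_out := bool.

Definition pick (v1 v2 : V) (l : bool) : V := if l then v2 else v1.

(* Input-output behaviour of one use of the pair of devices, whose inner
   workings are not trusted: [D v1 v2 w a b] is the probability of the outcomes
   [a] and [b] when Alice's device is given (v1, v2) and Bob's is given w. *)
Definition behaviour := V -> V -> V -> alice_out -> bob_out -> R.

Definition is_behaviour (D : behaviour) : Prop :=
  forall v1 v2 : V, orth (val v1) (val v2) -> forall l : bool,
    (forall a b, 0 <= D v1 v2 (pick v1 v2 l) a b) /\
    \sum_(a : alice_out) \sum_(b : bob_out) D v1 v2 (pick v1 v2 l) a b = 1.

(* [qutrits i j] is the coefficient of |ij> in (|00> + |11> + |22>) / sqrt 3. *)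
Definition qutrits : 'M[R]_3 := (Num.sqrt 3%:R)^-1%:M.

Definition alice_vector (v1 v2 : V) (a : alice_out) : 'rV[R]_3 :=
  normalize (match a with
             | Some l => val (pick v1 v2 l)
             | None => cross (val v1) (val v2)
             end).

(* The noiseless devices, by the Born rule. Projecting Alice's qutrit on the
   unit vector u leaves Bob with the unnormalized state [u *m qutrits]; the
   probability that Bob does not obtain w is what remains of its squared norm
   once the component along w is removed, whatever basis extends w. *)
Definition ideal_behaviour : behaviour := fun v1 v2 w a b =>
  let s := alice_vector v1 v2 a *m qutrits in
  let p := dot s (normalize (val w)) ^+ 2 in
  if b then p else dot s s - p.

(* On these devices the game condition always holds when Bob obtains w, which
   happens with probability 1/3. *)
Lemma ideal_behaviourE (v1 v2 : V) l a b :
  0%R \notin V -> orth (val v1) (val v2) ->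
  ideal_behaviour v1 v2 (pick v1 v2 l) a b
  = if a == Some l then (if b then 3%:R^-1 else 0)
    else (if b then 0 else 3%:R^-1).
Proof.
move=> V0 /eqP o12.
have nz (v : V) : val v != 0 by apply: contraNneq V0 => <-; exact: valP.
have sE (u : 'rV[R]_3) : u *m qutrits = (Num.sqrt 3%:R)^-1 *: u.
  by rewrite mul_mx_scalar.
have c2 : (Num.sqrt 3%:R)^-1 * (Num.sqrt 3%:R)^-1 = 3%:R^-1 :> R.
  by rewrite -expr2 exprVn sqr_sqrtr.
have unit_a : dot (alice_vector v1 v2 a) (alice_vector v1 v2 a) = 1.
  apply: dot_normalize; case: a => [l'|]; first exact: nz.
  by rewrite -dot_eq0 dot_cross o12 expr0n subr0 mulf_neq0// dot_eq0 nz.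
have aw : dot (alice_vector v1 v2 a) (normalize (val (pick v1 v2 l)))
    = (a == Some l)%:R.
  case: a {unit_a} => [l'|].
    have [->|ll'] := eqVneq (Some l') (Some l); first exact/dot_normalize/nz.
    apply: dot_normalize0; case: l' l ll' => -[] //= _.
    by rewrite dotC.
  by apply: dot_normalize0; case: l; rewrite ?dot_crossl ?dot_crossr.
rewrite /ideal_behaviour sE dotZl aw dotZZ c2 unit_a mulr1 exprMn expr2 c2.
by case: (a == Some l); case: b; rewrite ?expr1n ?expr0n/= ?mulr1 ?mulr0 ?subr0 ?subrr.
Qed.

Lemma ideal_behaviourP : 0%R \notin V -> is_behaviour ideal_behaviour.
Proof.
move=> V0 v1 v2 o12 l; split=> [a b|].
  by rewrite ideal_behaviourE//; case: ifP; case: b; rewrite ?invr_ge0.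
rewrite (eq_bigr (fun=> 3%:R^-1)) => [|a _].
  by rewrite sumr_const card_option card_bool -[LHS]mulr_natl mulfV// pnatr_eq0.
rewrite big_bool !ideal_behaviourE//=.
by case: ifP; rewrite ?addr0 ?add0r.
Qed.

End Devices.

(* The classical data of one round. [ell] is Bob's choice, [false] for v1 and
   [true] for v2. *)
Record qkd_round (R : realType) (V : {fset 'rV[R]_3}) := QkdRound {
  vec1 : V;
  vec2 : V;
  ell : bool;
  outA : alice_out;
  outB : bob_out }.

Section Rounds.
Variables (R : realType) (V : {fset 'rV[R]_3}).

Definition round_tuple (x : qkd_round V) :=
  (vec1 x, vec2 x, ell x, outA x, outB x).

Definition tuple_round (y : V * V * bool * option bool * bool) : qkd_round V :=
  let: (v1, v2, l, a, b) := y in QkdRound v1 v2 l a b.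

Lemma round_tupleK : cancel round_tuple tuple_round.
Proof. by case. Qed.

HB.instance Definition _ := Finite.copy (qkd_round V) (can_type round_tupleK).

(* The condition of the game in a round that is not discarded: Alice also
   obtains the vector that Bob has chosen and obtained. *)
Definition agree (x : qkd_round V) : bool := outA x == Some (ell x).

(* If Alice obtains va her outcome tells her nothing about Bob's choice; her
   bit is then an arbitrary guess, made from the vectors she has picked. *)
Definition bitA (guess : V -> V -> bool) (x : qkd_round V) : bool :=
  odflt (guess (vec1 x) (vec2 x)) (outA x).

Definition bitB (x : qkd_round V) : bool := ell x.

Definition round_law (pairlaw : V -> V -> R) (D : behaviour V) (x : qkd_round V) : R :=
  pairlaw (vec1 x) (vec2 x) * 2^-1
    * D (vec1 x) (vec2 x) (pick (vec1 x) (vec2 x) (ell x)) (outA x) (outB x).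

Definition is_pair_distribution (pairlaw : V -> V -> R) : Prop :=
  [/\ forall v1 v2, 0 <= pairlaw v1 v2,
      \sum_(v1 : V) \sum_(v2 : V) pairlaw v1 v2 = 1 &
      forall v1 v2, ~~ orth (val v1) (val v2) -> pairlaw v1 v2 = 0].

End Rounds.

(* The post-processing of N rounds [x]. The test rounds are chosen among the
   rounds that are kept by a selection rule [s], which is random in a run of
   the protocol; this allows any distribution of the test subset given the set
   of kept rounds. *)
Section PostProcessing.
Variables (R : realType) (V : {fset 'rV[R]_3}) (N : nat).
Implicit Types (x : 'I_N -> qkd_round V).

Definition selection := {ffun {set 'I_N} -> {set 'I_N}}.
Implicit Types (s : selection).

Definition kept x : {set 'I_N} := [set t | outB (x t)]%SET.

Definition tested x s : {set 'I_N} := kept x :&: s (kept x).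

Definition key_rounds x s : {set 'I_N} := kept x :\: tested x s.

(* It is 0 when there is no test round, in which case nothing is certified. *)
Definition estimate x s : R :=
  #|[set t in tested x s | agree (x t)]%SET|%:R / #|tested x s|%:R.

Definition aborts (eta : R) x s : bool := estimate x s < 1 - eta.

(* The enumeration of a set of rounds is in increasing order. *)
Definition keyA guess x s : seq bool :=
  [seq bitA guess (x t) | t <- enum (key_rounds x s)].

Definition keyB x s : seq bool := [seq bitB (x t) | t <- enum (key_rounds x s)].

End PostProcessing.

Section Probability.
Context d (T : measurableType d) (R : realType) (P : probability T R).

Definition Pr (A : set T) : R := fine (P A).

Definition Pr_given (E A : set T) : R := Pr (A `&` E) / Pr E.

(* The protocol is run on the memoryless devices D, Alice's pairs having
   distribution pairlaw. *)
Definition memoryless_run (V : {fset 'rV[R]_3}) (N : nat) (pairlaw : V -> V -> R)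
    (D : behaviour V) (X : 'I_N -> T -> qkd_round V) (S : T -> selection N) : Prop :=
  [/\ forall t x, measurable (X t @^-1` [set x]),
      forall s, measurable (S @^-1` [set s]),
      (* Bob's choice is uniform and every round uses the same devices *)
      forall t x, Pr (X t @^-1` [set x]) = round_law pairlaw D x &
      (* mutual independence of the rounds and of the selection of test rounds:
         for finite-valued variables the product rule for the whole family
         implies the one for each subfamily *)
      forall (x : 'I_N -> qkd_round V) s,
        Pr ([set w | (forall t, X t w = x t) /\ S w = s])
        = (\prod_(t < N) Pr (X t @^-1` [set x t])) * Pr (S @^-1` [set s])].

Section Run.
Variables (V : {fset 'rV[R]_3}) (N : nat).
Variables (X : 'I_N -> T -> qkd_round V) (S : T -> selection N).

(* The protocol does not abort and its entire raw key has length k. *)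
Definition completes (eta : R) (k : nat) : set T :=
  [set w | ~~ aborts eta (X^~ w) (S w) /\ #|key_rounds (X^~ w) (S w)| = k].

Definition KA guess (w : T) : seq bool := keyA guess (X^~ w) (S w).

Definition KB (w : T) : seq bool := keyB (X^~ w) (S w).

End Run.

(* The probabilities are those of the runs, with event E, that yield a pair of
   k-bit keys. *)
Definition tolerates_noise (E : set T) (k : nat) (KA KB : T -> seq bool)
    (eta : R) : Prop :=
  forall i : nat, (i < k)%N ->
    Pr_given E [set w | nth false (KA w) i <> nth false (KB w) i] <= eta.

Definition is_correct (E : set T) (KA KB : T -> seq bool) (eps : R) : Prop :=
  0 <= eps /\ Pr_given E [set w | KA w <> KB w] <= eps.

End Probability.

(* Main.v *)
Require Import Defs.
From HB Require Import structures.
From mathcomp Require Import all_boot all_order all_algebra.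
From mathcomp Require Import finmap.
From mathcomp Require Import all_classical all_reals all_analysis.

Set Implicit Arguments.
Unset Strict Implicit.
Unset Printing Implicit Defensive.

Import Order.TTheory GRing.Theory Num.Theory.
Local Open Scope classical_set_scope.
Local Open Scope ring_scope.

(** Fix the selection rule, the set of kept rounds and the set of test rounds
    in which the game is won.  They determine whether the run completes, and
    fixing them constrains each round separately, a key round being constrained
    only to be kept.  Hence, given completion, the rounds that yield the key are
    independent, and each follows the law of one round given that it is kept.
    So the bits of each position differ with the same probability [p <= eta],
    and the two keys coincide with probability [(1 - p) ^ k]. *)

Lemma prod_enum_index (R : comNzRingType) (I : finType) (J : {set I})
    (a : nat -> R) :
  \prod_(t in J) a (index t (enum J)) = \prod_(i < #|J|) a i.
Proof.
rewrite -big_enum cardE /=.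
have [->|[x0 _]] : enum J = [::] \/ exists x0, x0 \in enum J.
- by case: (enum J) => [|x r]; [left|right; exists x; rewrite inE eqxx].
- by rewrite big_nil big_ord0.
rewrite (big_nth x0) big_mkord; apply: eq_bigr => i _.
by rewrite index_uniq ?enum_uniq.
Qed.

Section KeyRounds.
Variables (R : realType) (V : {fset 'rV[R]_3}) (N : nat).
Implicit Types (s : selection N) (g : nat -> pred (qkd_round V)).

(** [g i] is imposed on the round that yields bit [i] of the key: the position of a round is its
    index in the increasing enumeration of the key rounds. *)
Definition key_satisfies g (x : 'I_N -> qkd_round V) s : bool :=
  [forall t in key_rounds x s, g (index t (enum (key_rounds x s))) (x t)].

Definition completing (eta : R) (k : nat) (x : 'I_N -> qkd_round V) s : bool :=
  ~~ aborts eta x s && (#|key_rounds x s| == k).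

(** An unnormalized conditional law: divided by the mass of [predT], it is the probability of [p]
    given that Bob keeps the round. *)
Definition kept_mass (mu : qkd_round V -> R) (p : pred (qkd_round V)) : R :=
  \sum_(y | outB y && p y) mu y.

(** [C] is chosen before [g], so when nonzero it cancels from the ratio of two such sums. *)
Lemma sum_completing (mu : qkd_round V -> R) (eta : R) (k : nat) s :
  exists C : R, forall g,
    \sum_(x : {ffun 'I_N -> qkd_round V}
            | completing eta k x s && key_satisfies g x s) \prod_t mu (x t)
    = C * \prod_(i < k) kept_mass mu (g i).
Proof.
(* The kept set [K] determines the test rounds [te K] and the key rounds [ke K]; [Q] collects the
   pairs of kept rounds and won test rounds for which the run completes. *)
pose te (K : {set 'I_N}) := (K :&: s K)%SET.
pose ke (K : {set 'I_N}) := (K :\: te K)%SET.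
pose won (x : {ffun 'I_N -> qkd_round V}) :=
  [set t in tested x s | agree (x t)]%SET.
pose Q (p : {set 'I_N} * {set 'I_N}) :=
  [&& #|ke p.1| == k, ~~ (#|p.2|%:R / #|te p.1|%:R < 1 - eta) & p.2 \subset te p.1].
(* Winning or losing is prescribed in test rounds only, so a key round is merely required to be
   kept. *)
pose c (p : {set 'I_N} * {set 'I_N}) (t : 'I_N) (y : qkd_round V) :=
  (outB y == (t \in p.1)) && ((t \in te p.1) ==> (agree y == (t \in p.2))).
(* The rounds outside the key contribute a factor free of [g]. *)
exists (\sum_(p | Q p) \prod_(t | t \notin ke p.1) \sum_(y | c p t y) mu y) => g.
rewrite (partition_big (fun x : {ffun _} => (kept x, won x)) Q); last first.
  move=> x /andP[/andP[nab ck] _]; rewrite /Q /= ck nab /=.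
  by apply/fintype.subsetP => t; rewrite inE => /andP[].
rewrite big_distrl /=; apply: eq_bigr => -[K A] /and3P[/= /eqP cK nab sA].
pose cg t y := c (K, A) t y && ((t \in ke K) ==> g (index t (enum (ke K))) y).
(* The constraint on the whole run is a conjunction of one-round constraints, so the sum of products
   will become a product of one-round sums. *)
transitivity (\sum_(x in family cg) \prod_(t < N) mu (x t)).
  apply: eq_bigl => x; apply/idP/idP.
    move=> /andP[/andP[_ /forall_inP gx] /eqP[kx wx]].
    have kE : key_rounds x s = ke K by rewrite /key_rounds /tested kx.
    apply/familyP => t; change (is_true (cg t (x t))); rewrite /cg /c /=.
    apply/andP; split; first apply/andP; first split.
    - by rewrite -kx finset.in_set.
    - rewrite -wx; apply/implyP => tT; rewrite finset.in_set.
      by rewrite /tested kx tT.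
    by apply/implyP => tJ; have := gx t; rewrite kE; apply.
  move=> /familyP fx.
  have kx : kept x = K.
    by apply/setP => t; have /andP[/andP[/eqP h _] _] := fx t; rewrite inE.
  have wx : won x = A.
    apply/finset.setP => t; rewrite finset.in_set /tested kx -/(te K).
    have /andP[/andP[_ /implyP h] _] := fx t.
    have [tT|tT] := boolP (t \in te K); first by rewrite (eqP (h tT)).
    by apply/esym/negbTE; apply: contra tT; exact: (fintype.subsetP sA).
  have kE : key_rounds x s = ke K by rewrite /key_rounds /tested kx.
  rewrite kx wx eqxx andbT /completing kE cK eqxx andbT.
  rewrite /aborts /estimate -/(won x) wx /tested kx nab /=.
  apply/forall_inP => t; rewrite kE => tJ.
  by have /andP[_ /implyP] := fx t; apply.
rewrite -(bigA_distr_big_dep _ (fun t y => mu y)).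
rewrite (bigID (mem (ke K))) /= mulrC; congr (_ * _).
  apply: eq_bigr => t /negbTE tJ; apply: eq_bigl => y.
  by rewrite /cg tJ andbT.
rewrite -cK -(prod_enum_index (ke K) (fun i => kept_mass mu (g i))).
apply: eq_bigr => t tJ; apply: eq_bigl => y.
rewrite /cg tJ /c /=.
have /finset.setDP[-> /negbTE ->] := tJ.
by rewrite andbT eqb_id.
Qed.

Variable guess : V -> V -> bool.

Definition mismatch (y : qkd_round V) : bool := bitA guess y != bitB y.

Lemma eq_keyE (x : 'I_N -> qkd_round V) s :
  (keyA guess x s == keyB x s) = key_satisfies (fun=> predC mismatch) x s.
Proof.
apply/eqP/forall_inP => [/eq_in_map e t tJ|e].
  by rewrite /= /mismatch negbK e// mem_enum.
by apply/eq_in_map => t; rewrite mem_enum => /e /negPn /eqP.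
Qed.

(** Only the round at position [i] is constrained. The bound on [i] matters: past the end both bits
    read the default [false], while the right-hand side holds vacuously. *)
Lemma nth_keyE (x : 'I_N -> qkd_round V) s (i : nat) :
  (i < #|key_rounds x s|)%N ->
  (nth false (keyA guess x s) i != nth false (keyB x s) i)
  = key_satisfies (fun j => if j == i then mismatch else predT) x s.
Proof.
rewrite cardE => ik; have t0 : 'I_N by case: (enum _) ik.
rewrite /keyA /keyB !(nth_map t0)//.
apply/idP/forall_inP => [e t tJ|].
  case: eqP => // ti; rewrite -ti nth_index ?mem_enum// in e.
move=> /(_ (nth t0 (enum (key_rounds x s)) i)).
by rewrite -mem_enum mem_nth// index_uniq ?enum_uniq// eqxx; apply.
Qed.

End KeyRounds.

Section Run.
Context d (T : measurableType d) (R : realType) (P : probability T R).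

Lemma Pr_finite_valued (F : finType) (Y : T -> F) (Q : pred F) :
  (forall y, measurable (Y @^-1` [set y])) ->
  Pr P [set w | Q (Y w)] = \sum_(y | Q y) Pr P (Y @^-1` [set y]).
Proof.
move=> mY; rewrite /Pr sum_fine; last by move=> y _; exact: fin_num_measure.
have -> : [set w | Q (Y w)] = \bigcup_(y in [set` enum Q]) (Y @^-1` [set y]).
  apply/seteqP; split=> w /=.
    by move=> Qw; exists (Y w); rewrite //= mem_enum.
  by move=> [y /=]; rewrite mem_enum => Qy ->.
rewrite measure_fin_bigcup//; last exact: trivIset_preimage1.
by rewrite -fsbig_seq ?enum_uniq// big_enum.
Qed.

Variables (V : {fset 'rV[R]_3}) (N : nat) (pairlaw : V -> V -> R).
Variables (D : behaviour V) (X : 'I_N -> T -> qkd_round V) (S : T -> selection N).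
Hypothesis run : memoryless_run P pairlaw D X S.
Implicit Types Q : ('I_N -> qkd_round V) -> selection N -> bool.

(** The selection rule and the [N] rounds form a single finite-valued variable, whose law is a
    product by independence. *)
Lemma Pr_run Q : Pr P [set w | Q (X^~ w) (S w)] =
  \sum_(s : selection N) \sum_(x : {ffun 'I_N -> qkd_round V} | Q x s)
    (\prod_t round_law pairlaw D (x t)) * Pr P (S @^-1` [set s]).
Proof.
have [mX mS law indep] := run.
pose Y w := (S w, [ffun t => X t w]).
have YE s (x : {ffun _}) : Y @^-1` [set (s, x)]
    = [set w | (forall t, X t w = x t) /\ S w = s].
  apply/seteqP; split=> w /=.
    by move=> [<- <-]; split=> // t; rewrite ffunE.
  by move=> [Xx <-]; congr pair; apply/ffunP => t; rewrite ffunE.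
have fX w : [ffun t => X t w] = X^~ w :> ('I_N -> _).
  by apply/funext => t; rewrite ffunE.
pose QY (z : selection N * {ffun 'I_N -> qkd_round V}) := Q z.2 z.1.
transitivity (Pr P [set w | QY (Y w)]).
  by congr (Pr P _); apply/seteqP; split=> w; rewrite /= /QY /= fX.
rewrite Pr_finite_valued; last first.
  move=> [s x]; rewrite YE.
  have -> : [set w | (forall t, X t w = x t) /\ S w = s]
      = (\bigcap_(t in [set: 'I_N]) (X t @^-1` [set x t])) `&` (S @^-1` [set s]).
    apply/seteqP; split=> w /= [Xx Ss]; split=> // t.
      by move=> _; exact: Xx.
    exact: Xx.
  by apply: measurableI => //; exact: fin_bigcap_measurable.
rewrite pair_big_dep /=; apply: eq_bigr => -[s x] _ /=.
by rewrite YE indep; congr (_ * _); apply: eq_bigr.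
Qed.

(** Additivity is read off the finite sums, so no measurability of the two events has to be
    checked. *)
Lemma Pr_run_diff Q Q' :
  Pr P [set w | Q (X^~ w) (S w) && ~~ Q' (X^~ w) (S w)] =
  Pr P [set w | Q (X^~ w) (S w)]
  - Pr P [set w | Q (X^~ w) (S w) && Q' (X^~ w) (S w)].
Proof.
rewrite (Pr_run (fun x s => Q x s && ~~ Q' x s)) (Pr_run Q).
rewrite (Pr_run (fun x s => Q x s && Q' x s)) -sumrB; apply: eq_bigr => s _.
by rewrite [X in X - _](bigID (fun x : {ffun _} => Q' x s)) /= addrC addrK.
Qed.

Lemma Pr_completing (eta : R) (k : nat) : exists C : R, forall g,
  Pr P [set w | completing eta k (X^~ w) (S w) && key_satisfies g (X^~ w) (S w)]
  = C * \prod_(i < k) kept_mass (round_law pairlaw D) (g i).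
Proof.
have [C CE] := boolp.choice (@sum_completing _ _ N (round_law pairlaw D) eta k).
(* The selection rule is independent of the rounds, so it is averaged out into the constant. *)
exists (\sum_s C s * Pr P (S @^-1` [set s])) => g.
rewrite (Pr_run (fun x s => completing eta k x s && key_satisfies g x s)).
rewrite big_distrl /=; apply: eq_bigr => s _ /=.
by rewrite -big_distrl /= CE mulrAC.
Qed.

End Run.

Theorem mainTheorem2 (R : realType) (d : measure_display) (T : measurableType d)
    (P : probability T R) (V : {fset 'rV[R]_3}) (N : nat) (eta : R) (k : nat)
    (pairlaw : V -> V -> R) (D : behaviour V) (guess : V -> V -> bool)
    (X : 'I_N -> T -> qkd_round V) (S : T -> selection N)
    (hV : kochen_specker V)
    (hpairlaw : is_pair_distribution pairlaw)
    (hD : is_behaviour D)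
    (hrun : memoryless_run P pairlaw D X S)
    (heta0 : 0 <= eta) (heta1 : eta <= 1)
    (hcompletes : 0 < Pr P (completes X S eta k))
    (hnoise : tolerates_noise P (completes X S eta k) k (KA X S guess) (KB X S) eta) :
  is_correct P (completes X S eta k) (KA X S guess) (KB X S) (1 - (1 - eta) ^+ k).
Proof.
have p01 : 0 <= 1 - eta <= 1 by rewrite subr_ge0 heta1 lerBlDr lerDl.
split; first by rewrite subr_ge0 exprn_ile1 ?(andP p01).1 ?(andP p01).2.
have [C CE] := Pr_completing hrun eta k.
pose q := kept_mass (round_law pairlaw D) predT.
pose b := kept_mass (round_law pairlaw D) (mismatch guess).
pose a := kept_mass (round_law pairlaw D) (predC (mismatch guess)).
have abE : a = q - b.
  rewrite /q /kept_mass (bigID (mismatch guess)) /= addrC.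
  under [X in _ = _ + X - _]eq_bigl do rewrite andbT.
  rewrite addrK; apply: eq_bigl => y.
  by rewrite andbT.
have complP w : completes X S eta k w <-> completing eta k (X^~ w) (S w).
  rewrite /completes /completing /=; split=> [[-> ->]|/andP[-> /eqP]]//.
  by rewrite eqxx.
have PE : Pr P (completes X S eta k) = C * q ^+ k.
  rewrite -[in RHS](card_ord k) -prodr_const -(CE (fun=> predT)).
  congr (Pr P _); apply/seteqP; split=> w /=.
    by move=> /complP ->; apply/forall_inP.
  by move=> /andP[/complP].
have PEne0 : C * q ^+ k != 0 by rewrite -PE gt_eqF.
(* Only [q ^+ k] is known to be nonzero here: for an empty key, [q] itself could vanish. *)
have [C0 q0] : C != 0 /\ q ^+ k != 0.
  by move: PEne0; rewrite mulf_eq0 negb_or => /andP.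
(* [b / q] is the probability that the two bits of a kept round differ. *)
have bit i : (i < k)%N -> b / q <= eta.
  move=> ik; have qn0 : q != 0.
    apply: contraNneq q0 => ->.
    by rewrite expr0n -leqn0 leqNgt (leq_ltn_trans _ ik).
  have := hnoise i ik; rewrite /Pr_given PE.
  set A := (A in Pr P A).
  have -> : A = [set w | completing eta k (X^~ w) (S w)
      && key_satisfies (fun j => if j == i then mismatch guess else predT)
           (X^~ w) (S w)].
    rewrite /A; apply/seteqP; split=> w /=.
      move=> [ne /complP cw]; rewrite cw; move/andP: cw => [_ /eqP ck].
      by rewrite -nth_keyE ?ck//; apply/eqP.
    move=> /andP[cw]; move/andP: (cw) => [_ /eqP ck].
    by rewrite -nth_keyE ?ck// => /eqP; split=> //; exact/complP.
  (* Position [i] contributes [b] and each of the other [k - 1] positions contributes [q]. *)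
  rewrite CE (bigD1 (Ordinal ik)) //= eqxx (eq_bigr (fun=> q)); last first.
    by move=> j; rewrite -val_eqE /= => /negbTE ->.
  rewrite prodr_const cardC1 card_ord -/b.
  suff -> : C * (b * q ^+ k.-1) / (C * q ^+ k) = b / q by [].
  rewrite -{2}(ltn_predK ik) exprS invfM mulrACA divff// mul1r invfM.
  by rewrite mulrACA divff ?mulr1// expf_neq0.
rewrite /Pr_given PE.
set A := (A in Pr P A).
have -> : A = [set w | completing eta k (X^~ w) (S w)
    && ~~ key_satisfies (fun=> predC (mismatch guess)) (X^~ w) (S w)].
  rewrite /A; apply/seteqP; split=> w /=; rewrite -eq_keyE.
    by move=> [ne /complP ->]; apply/eqP.
  by move=> /andP[cw /eqP ne]; split=> //; exact/complP.
(* The keys coincide with conditional probability [(a / q) ^+ k], which is to be bounded below by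
   [(1 - eta) ^+ k]. *)
rewrite (Pr_run_diff hrun (completing eta k)) CE prodr_const card_ord -/a.
have -> : Pr P [set w | completing eta k (X^~ w) (S w)] = C * q ^+ k.
  by rewrite -PE; congr (Pr P _); apply/seteqP; split=> w /complP.
rewrite mulrBl divff// -mulf_div divff// mul1r -expr_div_n lerD2l lerN2.
have [->|k0] := posnP k; first by rewrite !expr0.
have qn0 : q != 0 by move: q0; rewrite expf_eq0 k0.
(* The noise bound at position 0 suffices, since [b / q] is the same at every position. *)
have le : 1 - eta <= a / q by rewrite abE mulrBl divff// lerD2l lerN2 (bit _ k0).
apply: lerXn2r => //; rewrite nnegrE ?(andP p01).1//.
by rewrite (le_trans _ le) ?(andP p01).1.
Qed.
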